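(* Let $A$ be an $m\times n$ complex matrix such that the sum of all entries of $AA^{*}$ is nonzero. Then for all integers $r\ge 0$ and $p\ge 1$, $$\sigma^{2p}(A)\ge \frac{w_A^{r+p}}{w_A^{r}} .$$
   Context: For a positive integer $N$, $[N]=\{1,\dots,N\}$. $\sigma(A)$ denotes the largest singular value of $A$, $A^{*}$ its conjugate transpose, and $\sigma^{2p}(A)=(\sigma(A))^{2p}$. For an integer $r\ge 0$ and $i,j\in[m]$, $w_A^r(i,j)$ denotes the $(i,j)$ entry of $(AA^{*})^r$ (with $(AA^* )^0=I_m$), and $w_A^r=\sum_{k\in[m]}\sum_{i\in[m]}w_A^r(k,i)$ is the sum of all entries of $(AA^{*})^r$, which is a real number since $(AA^* )^r$ is Hermitian. *)

(* Defs.v *)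
From mathcomp Require Import all_boot all_order all_algebra.
From mathcomp Require Import complex.
From mathcomp Require Import classical_sets reals.

Set Implicit Arguments.
Unset Strict Implicit.
Unset Printing Implicit Defensive.

Import Order.TTheory GRing.Theory Num.Theory.
Local Open Scope classical_set_scope.
Local Open Scope ring_scope.
Local Open Scope sesquilinear_scope.
Local Open Scope complex_scope.

(* [eigenvalue] is stated with row vectors, but has the usual meaning (the roots
   of the characteristic polynomial). When [m < n] the value [0] is listed in
   addition to the [minn m n] singular values of [A]; this does not affect the
   largest one when [0 < m]. *)
Definition singular_values (R : realType) (m n : nat) (A : 'M[R[i]]_(m, n)) :
    set R :=
  [set s : R | 0 <= s /\ eigenvalue (A^t* *m A) (s ^+ 2)%:C].

(* This supremum is a maximum as soon as [0 < n]: see [sigma_singular_value] and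
   [singular_value_le_sigma]. *)
Definition sigma (R : realType) (m n : nat) (A : 'M[R[i]]_(m, n)) : R :=
  sup (singular_values A).

Definition walk_entry (R : realType) (m n : nat) (A : 'M[R[i]]_(m, n)) (r : nat)
    (i j : 'I_m) : R[i] :=
  ((A *m A^t* ) ^+ r) i j.

(* A real number, kept in [R[i]]: there [x <= y] means that [y - x] is real and
   nonnegative. *)
Definition walk_sum (R : realType) (m n : nat) (A : 'M[R[i]]_(m, n)) (r : nat) :
    R[i] :=
  \sum_(k < m) \sum_(i < m) walk_entry A r k i.

Lemma eigenvalue_gram_ge0 (C : numClosedFieldType) (m n : nat)
    (A : 'M[C]_(m, n)) (a : C) :
  eigenvalue (A^t* *m A) a -> 0 <= a.
Proof.
move=> /eigenvalueP[v vA vN0].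
have vv : 0 < (v *m v^t* ) 0 0 by rewrite -dotmxE dnorm_gt0.
have : 0 <= ((v *m A^t* ) *m (v *m A^t* )^t* ) 0 0 by rewrite -dotmxE dnorm_ge0.
rewrite trmx_mul map_mxM trmxCK mulmxA -(mulmxA v) vA -scalemxAl mxE.
by rewrite pmulr_lge0.
Qed.

Lemma ge0_complexE (R : realType) (z : R[i]) :
  0 <= z -> z = (Num.sqrt (complex.Re z) ^+ 2)%:C.
Proof.
case: z => x y; rewrite lecE => /andP[/eqP y0 x0].
by apply/eqP; rewrite eq_complex /= sqr_sqrtr// [y]y0 !eqxx.
Qed.

Lemma singular_values_max (R : realType) (m n : nat) (A : 'M[R[i]]_(m, n)) :
  (0 < n)%N ->
  exists2 s, singular_values A s & forall t, singular_values A t -> t <= s.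
Proof.
move=> n0.
have [rs rsE] := closed_field_poly_normal (char_poly (A^t* *m A)).
rewrite (monicP (char_poly_monic _)) scale1r in rsE.
have eigE a : eigenvalue (A^t* *m A) a = (a \in rs).
  by rewrite eigenvalue_root_char rsE root_prod_XsubC.
pose f (z : R[i]) := Num.sqrt (complex.Re z).
have fP z : z \in rs -> singular_values A (f z).
  rewrite -eigE => zA; split; first exact: sqrtr_ge0.
  by rewrite -(ge0_complexE (eigenvalue_gram_ge0 zA)).
have Pf t : singular_values A t -> exists2 z, z \in rs & t = f z.
  move=> [t0]; rewrite eigE => tA; exists (t ^+ 2)%:C => //.
  by rewrite /f /= sqrtr_sqr ger0_norm.
have [a] := eigenvalue_closed (A^t* *m A) n0; rewrite eigE => ars.
have : exists2 z, z \in rs & forall z', z' \in rs -> f z' <= f z.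
  elim: rs a ars {rsE eigE fP Pf} => // x rs IH _ _.
  case: rs IH => [_|y rs /(_ y (mem_head _ _))[z zrs zmax]].
    by exists x; rewrite ?mem_head// => z'; rewrite inE => /eqP ->.
  have [fxz|fzx] := leP (f x) (f z).
    exists z; first by rewrite inE zrs orbT.
    by move=> z'; rewrite inE => /predU1P[->//|/zmax].
  exists x; first exact: mem_head.
  by move=> z'; rewrite inE => /predU1P[->//|/zmax/le_trans]; apply; exact: ltW.
move=> [z zrs zmax]; exists (f z); first exact: fP.
by move=> t /Pf[z' z'rs ->]; exact: zmax.
Qed.

Lemma singular_value_le_sigma (R : realType) (m n : nat) (A : 'M[R[i]]_(m, n))
    (s : R) :
  (0 < n)%N -> singular_values A s -> s <= sigma A.
Proof.
move=> n0 sA; have [t _ tmax] := singular_values_max A n0.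
by apply: ub_le_sup => //; exists t => u /tmax.
Qed.

Lemma sigma_singular_value (R : realType) (m n : nat) (A : 'M[R[i]]_(m, n)) :
  (0 < n)%N -> singular_values A (sigma A).
Proof.
move=> n0; have [t tA tmax] := singular_values_max A n0.
suff -> : sigma A = t by [].
apply/eqP; rewrite eq_le (singular_value_le_sigma n0 tA) andbT.
by apply: ge_sup; [exists t | move=> u /tmax].
Qed.

(* Main.v *)
(* Diagonalizing the Hermitian matrix A A^* in an orthonormal eigenbasis gives
   w_A^r = sum_i |y_i|^2 d_i^r for every r, where the y_i are the coordinates of
   the all-ones vector and the d_i are the eigenvalues of A A^*. Each d_i lies in
   [0, sigma(A)^2], because a nonzero eigenvalue of A A^* is also one of A^* A;
   hence w_A^(r+p) <= sigma(A)^(2p) w_A^r termwise. *)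

Require Import Defs.
From mathcomp Require Import all_boot all_order all_algebra.
From mathcomp Require Import complex.
From mathcomp Require Import classical_sets reals.

Import Order.TTheory GRing.Theory Num.Theory.
Local Open Scope ring_scope.
Local Open Scope sesquilinear_scope.
Local Open Scope complex_scope.

(** If [v] is an eigenvector of [A *m B], then [v *m A] is one of [B *m A]; it is nonzero because
    [v *m A *m B = a *: v] and [a != 0]. *)
Lemma eigenvalue_mulmxC (F : fieldType) (m n : nat) (A : 'M[F]_(m, n))
    (B : 'M[F]_(n, m)) (a : F) :
  a != 0 -> eigenvalue (A *m B) a -> eigenvalue (B *m A) a.
Proof.
move=> a0 /eigenvalueP[v vAB vN0]; apply/eigenvalueP; exists (v *m A).
  by rewrite mulmxA -(mulmxA v) vAB -scalemxAl.
apply: contra_neq vN0 => vA0; apply/(scalerI a0).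
by rewrite scaler0 -vAB mulmxA vA0 mul0mx.
Qed.

Lemma eigenvalue_le_sigma (R : realType) (m n : nat) (A : 'M[R[i]]_(m, n))
    (a : R[i]) :
  eigenvalue (A *m A^t* ) a -> 0 <= a <= (sigma A ^+ 2)%:C.
Proof.
(* Zero is treated apart: it need not be an eigenvalue of [A^t* *m A]. *)
move=> aA; have [->|a0] := eqVneq a 0; first by rewrite lexx /= ler0c sqr_ge0.
have aAA : eigenvalue (A^t* *m A) a by exact: eigenvalue_mulmxC.
have age0 := eigenvalue_gram_ge0 aAA.
have n0 : (0 < n)%N.
  have /eigenvalueP[v _] := aAA; case: n v {A aA aAA} => // v.
  by rewrite thinmx0 eqxx.
set s := Num.sqrt (complex.Re a).
have sA : singular_values A s.
  by split; [exact: sqrtr_ge0 | rewrite -(ge0_complexE age0)].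
have [sigma0 _] := sigma_singular_value A n0.
rewrite age0 (ge0_complexE age0) lecR ler_pXn2r ?nnegrE ?sqrtr_ge0//.
exact: singular_value_le_sigma sA.
Qed.

Lemma eigenvalue_spectral_diag (C : numClosedFieldType) (n : nat) (M : 'M[C]_n)
    (i : 'I_n) :
  M \is normalmx -> eigenvalue M (spectral_diag M 0 i).
Proof.
move=> /orthomx_spectralP ME; apply/eigenvalueP.
exists (row i (spectralmx M)).
  rewrite -row_mul [X in _ *m X]ME !mulmxA mulmxV ?spectral_unit// mul1mx.
  by rewrite row_mul row_diag_mx -scalemxAl -rowE.
(* A row of a unitary matrix has norm 1, so it cannot vanish. *)
apply/eqP => Pi0; have /row_unitarymxP/(_ i i) := spectral_unitarymx M.
by rewrite Pi0 linear0l eqxx => /eqP; rewrite eq_sym oner_eq0.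
Qed.

Lemma spectral_expE (C : numClosedFieldType) (n : nat) (M : 'M[C]_n) (r : nat) :
  M \is normalmx ->
  M ^+ r = invmx (spectralmx M) *m
    diag_mx (\row_i spectral_diag M 0 i ^+ r) *m spectralmx M.
Proof.
move=> /orthomx_spectralP ME; elim: r => [|r IH].
  rewrite expr0 (_ : diag_mx _ = 1%:M) ?mulmx1 ?mulVmx ?spectral_unit//.
  by apply/matrixP => i j; rewrite !mxE.
rewrite exprS -[_ * _]/(_ *m _) IH {1}ME !mulmxA mulmxK ?spectral_unit//.
rewrite -(mulmxA _ (diag_mx _) (diag_mx _)) mulmx_diag; congr (_ *m diag_mx _ *m _).
by apply/rowP => i; rewrite !mxE exprS.
Qed.

(** The weights [y] are chosen before [r], so that walk sums of different lengths can be compared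
    term by term. *)
Lemma walk_sum_spectral (R : realType) (m n : nat) (A : 'M[R[i]]_(m, n)) :
  exists y : 'I_m -> R[i], forall r : nat,
    walk_sum A r =
      \sum_i `|y i| ^+ 2 * spectral_diag (A *m A^t* ) 0 i ^+ r.
Proof.
have Mnormal : A *m A^t* \is normalmx.
  by apply/normalmxP; rewrite trmx_mul map_mxM trmxCK.
set M := A *m A^t* in Mnormal *.
pose e : 'rV[R[i]]_m := const_mx 1; pose y := e *m (spectralmx M)^t*.
exists (y 0) => r.
have -> : walk_sum A r = (e *m M ^+ r *m e^t* ) 0 0.
  rewrite mxE /walk_sum exchange_big; apply: eq_bigr => i _.
  rewrite !mxE conjC1 mulr1; apply: eq_bigr => k _.
  by rewrite !mxE mul1r.
(* Unitarity turns the inverse into a conjugate transpose, so the outer factors become [y] and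
   [y^t*]. *)
rewrite spectral_expE// invmx_unitary ?spectral_unitarymx//.
rewrite !mulmxA -/y -mulmxA.
have -> : spectralmx M *m e^t* = y^t* by rewrite trmx_mul map_mxM trmxCK.
rewrite mxE; apply: eq_bigr => i _.
by rewrite mul_mx_diag !mxE normCK mulrAC.
Qed.

Theorem theorem2 (R : realType) (m n : nat) (A : 'M[R[i]]_(m, n))
    (hA : \sum_(i < m) \sum_(j < m) (A *m A^t* ) i j != 0)
    (r p : nat) (hp : (1 <= p)%N) :
  walk_sum A (r + p) / walk_sum A r <= (sigma A ^+ (2 * p))%:C.
Proof.
have [y wE] := walk_sum_spectral _ _ _ A.
have dP i : 0 <= spectral_diag (A *m A^t* ) 0 i <= (sigma A ^+ 2)%:C.
  apply/eigenvalue_le_sigma/eigenvalue_spectral_diag/normalmxP.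
  by rewrite trmx_mul map_mxM trmxCK.
have [w0|w0] := eqVneq (walk_sum A r) 0.
  (* [x / 0 = 0] *)
  by rewrite w0 invr0 mulr0 ler0c exprM exprn_ge0// sqr_ge0.
(* The denominator is a nonzero sum of nonnegative terms, hence positive. *)
rewrite ler_pdivrMr; last first.
  rewrite lt_def w0 wE sumr_ge0// => i _.
  by have /andP[d0 _] := dP i; rewrite mulr_ge0 ?exprn_ge0.
rewrite !wE mulr_sumr ler_sum// => i _; have /andP[d0 ds] := dP i.
(* For each eigenvalue [d], it remains to bound the factor [d ^+ p] of [d ^+ (r + p)] by
   [(sigma A ^+ 2) ^+ p]. *)
rewrite mulrCA ler_wpM2l ?exprn_ge0// exprD mulrC ler_wpM2r ?exprn_ge0//.
by rewrite exprM rmorphXn lerXn2r// nnegrE// (le_trans d0).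
Qed.
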